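(* Let $\frac12<\gamma_0<\lambda_0<1$. Suppose there is a unique function $h\in\mathcal B$ with $h(\gamma_0)=h(\lambda_0)=0$, and suppose moreover that all but finitely many coefficients of $h$ are equal to $+1$ and that $h'(\gamma_0)<0$ and $h'(\lambda_0)>0$. Put $z_0=(\gamma_0,\lambda_0)$ and $\alpha=\frac{\log\lambda_0}{\log\gamma_0}$. Then $z_0$ is a ''tip of a corner'' of $\mathcal N_+$ with zero interior angle, in the following precise sense: there exist $\delta>0$ and positive constants $C_1,C_2$ such that $$\bigl(B_\delta(z_0)\cap\mathcal N_+\bigr)\setminus\{z_0\}\subset\bigl\{(\gamma,\lambda):\ \gamma<\gamma_0,\ \ C_1(\gamma_0-\gamma)^\alpha<\lambda-\lambda_0<C_2(\gamma_0-\gamma)^\alpha\bigr\}.$$ In fact, one can take $$C_1=\frac{2|h'(\gamma_0)|^\alpha(1-\gamma_0)^\alpha}{2^\alpha\cdot 3\,h'(\lambda_0)},\qquad C_2=\frac{3^\alpha\cdot 2\,|h'(\gamma_0)|^\alpha}{2^\alpha(1-\lambda_0)h'(\lambda_0)}.$$ In particular, the conditions that $\frac12<\gamma_0<\lambda_0<1$, that $h$ is the unique function in $\mathcal B$ vanishing at both $\gamma_0$ and $\lambda_0$, that all but finitely many coefficients of $h$ are equal to $+1$, and that $h'(\gamma_0)<0$ and $h'(\lambda_0)>0$, are satisfied whenever $\gamma_0<\lambda_0$ are two zeros in $(0,1)$ of a function of the form $$h(x)=1-x-\cdots-x^{k-1}+ax^k+\frac{x^{k+1}}{1-x}$$ for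 some integer $k\ge1$ and some $a\in\{-1,0,1\}$.
   Context: $\mathcal B=\{1+\sum_{n=1}^\infty b_nz^n:\ b_n\in\{-1,0,1\}\}$, a set of power series (convergent in the open unit disk). $\mathcal N_+=\{(\gamma,\lambda):\ 0<\gamma<\lambda<1\text{ and there is } f\in\mathcal B\text{ with } f(\gamma)=f(\lambda)=0\}$. $B_\delta(z_0)$ is the open disk in $\mathbb R^2$ of radius $\delta$ centered at $z_0$. *)

(* Defs.v *)
From Stdlib Require Import Reals.
From Coquelicot Require Import Coquelicot.
Open Scope R_scope.

Definition digit (c : R) : Prop := c = -1 \/ c = 0 \/ c = 1.

(** A power series is given by its coefficient sequence [f : nat -> R], and
    its value at [x] is [PSeries f x].  [PSeries] is total, but is only ever
    used here at points of absolute value less than 1, where the series of an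
    element of [calB] converges absolutely. *)
Definition calB (f : nat -> R) : Prop :=
  f 0%nat = 1 /\ forall n : nat, (1 <= n)%nat -> digit (f n).

Definition vanishes_at_both (g l : R) (f : nat -> R) : Prop :=
  calB f /\ PSeries f g = 0 /\ PSeries f l = 0.

Definition N_plus (z : R * R) : Prop :=
  0 < fst z /\ fst z < snd z /\ snd z < 1 /\
  exists f : nat -> R, vanishes_at_both (fst z) (snd z) f.

(** The open disk for the Euclidean distance, whereas Coquelicot's [ball] on
    [R * R] is a square. *)
Definition disk (delta : R) (z0 z : R * R) : Prop :=
  dist_euc (fst z0) (snd z0) (fst z) (snd z) < delta.

Definition corner_hypotheses (g0 l0 : R) (h : nat -> R) : Prop :=
  1 / 2 < g0 /\ g0 < l0 /\ l0 < 1 /\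
  vanishes_at_both g0 l0 h /\
  (forall f : nat -> R, vanishes_at_both g0 l0 f -> forall n : nat, f n = h n) /\
  eventually (fun n => h n = 1) /\
  Derive (PSeries h) g0 < 0 /\
  0 < Derive (PSeries h) l0.

(** [Rpower] is the usual real power only for a positive base; the base
    [g0 - fst z] is positive because of the conjunct [fst z < g0]. *)
Definition corner_region (g0 l0 alpha C1 C2 : R) (z : R * R) : Prop :=
  fst z < g0 /\
  C1 * Rpower (g0 - fst z) alpha < snd z - l0 /\
  snd z - l0 < C2 * Rpower (g0 - fst z) alpha.

Definition corner_inclusion (g0 l0 alpha delta C1 C2 : R) : Prop :=
  forall z : R * R,
    disk delta (g0, l0) z -> N_plus z -> z <> (g0, l0) ->
    corner_region g0 l0 alpha C1 C2 z.

(** The function [1 - x - ... - x^(k-1) + a x^k + x^(k+1) / (1 - x)]; the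
    middle sum is empty for [k = 1], as [sum_n_m _ 1 0] is zero. *)
Definition special_fun (k : nat) (a x : R) : R :=
  1 - sum_n_m (fun j : nat => x ^ j) 1 (k - 1)
    + a * x ^ k + x ^ (k + 1) / (1 - x).

(* Main.v *)
(** If [f] in [calB] vanishes at a point [(x, y)] close to [(g0, l0)], then by
    compactness and uniqueness it agrees with [h] up to a large index [m]. From
    there on [h n = 1], so [h - f] has coefficients in {0, 1, 2} and
    [t^m <= h t <= 2 t^m / (1 - t)] at [t = x] and [t = y]. The signs of [h'] put
    [(x, y)] in the quadrant [x < g0], [l0 < y], and linearizing [h] compares
    [g0 - x] with [g0^m] and [y - l0] with [l0^m = (g0^m)^alpha].

    For the special functions, the coefficients of [h - f] and those of
    [x h'(x) - h(x)] change sign only once, at index [k]; such a series divided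
    by [x^k] is strictly increasing, so it has at most one zero. *)
Require Import Defs.
From Stdlib Require Import Reals Lra Lia Arith ClassicalEpsilon.
From Coquelicot Require Import Coquelicot.
Open Scope R_scope.

(** * Convergence and size of power series with bounded coefficients *)

Lemma digit_bound (c : R) : digit c -> -1 <= c <= 1.
Proof. intros [H|[H|H]]; lra. Qed.

Lemma calB_digit (f : nat -> R) : calB f -> forall n, digit (f n).
Proof.
intros [H0 H] [|n].
- right; right; exact H0.
- apply H; lia.
Qed.

Lemma calB_Rabs (f : nat -> R) : calB f -> forall n, Rabs (f n) <= 1.
Proof.
intros H n; apply Rabs_le, digit_bound, calB_digit, H.
Qed.

Lemma CV_radius_bounded_coef (a : nat -> R) (M x : R) :
  (forall n, Rabs (a n) <= M) -> Rabs x < 1 ->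
  Rbar_lt (Finite (Rabs x)) (CV_radius a).
Proof.
intros Ha Hx.
apply Rbar_lt_le_trans with (Finite 1); [exact Hx|].
apply (proj1 (CV_radius_bounded a)).
exists M; intros n; rewrite pow1, Rmult_1_r; apply Ha.
Qed.

Lemma ex_pseries_bounded_coef (a : nat -> R) (M x : R) :
  (forall n, Rabs (a n) <= M) -> Rabs x < 1 -> ex_pseries a x.
Proof.
intros Ha Hx; apply CV_radius_inside, CV_radius_bounded_coef with M; assumption.
Qed.

Lemma is_derive_PSeries_calB (f : nat -> R) (x : R) :
  calB f -> Rabs x < 1 ->
  is_derive (PSeries f) x (Derive (PSeries f) x).
Proof.
intros Hf Hx.
assert (Hr := CV_radius_bounded_coef f 1 x (calB_Rabs f Hf) Hx).
rewrite Derive_PSeries by assumption.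
apply is_derive_PSeries; assumption.
Qed.

Lemma Series_ge_term (a : nat -> R) (k : nat) :
  (forall n, 0 <= a n) -> ex_series a -> a k <= Series a.
Proof.
intros Ha Hs.
assert (Hl : is_lim_seq (sum_n a) (Series a)) by exact (Series_correct a Hs).
assert (Hk : sum_n a k <= Series a).
{ apply (is_lim_seq_incr_compare _ _ Hl).
  intros n; rewrite sum_Sn; unfold plus; simpl.
  specialize (Ha (S n)); lra. }
apply Rle_trans with (2 := Hk).
destruct k as [|k]; [rewrite sum_O; lra|].
rewrite sum_Sn; unfold plus; simpl.
enough (0 <= sum_n a k) by lra.
rewrite sum_n_Reals; apply cond_pos_sum, Ha.
Qed.

Lemma PSeries_tail_bound (a : nat -> R) (M x : R) (m : nat) :
  (forall n, (n < m)%nat -> a n = 0) -> (forall n, Rabs (a n) <= M) ->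
  0 <= x < 1 -> Rabs (PSeries a x) <= M * x ^ m / (1 - x).
Proof.
intros H0 HM Hx.
assert (Hax : Rabs x = x) by (apply Rabs_pos_eq; lra).
rewrite (PSeries_decr_n_aux a m x H0), Rabs_mult, (Rabs_pos_eq (x ^ m))
  by (apply pow_le; lra).
replace (M * x ^ m / (1 - x)) with (x ^ m * (M * / (1 - x))) by (field; lra).
apply Rmult_le_compat_l; [apply pow_le; lra|].
assert (Hgeo : ex_series (fun n => M * x ^ n)).
{ apply @ex_series_scal_l with (a := fun n => x ^ n).
  apply ex_series_geom; rewrite Hax; lra. }
rewrite <- (Series_geom x) by (rewrite Hax; lra).
rewrite <- Series_scal_l.
assert (Hle : forall n, 0 <= Rabs (PS_decr_n a m n * x ^ n) <= M * x ^ n).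
{ intros n; split; [apply Rabs_pos|].
  rewrite Rabs_mult, (Rabs_pos_eq (x ^ n)) by (apply pow_le; lra).
  apply Rmult_le_compat_r; [apply pow_le; lra| apply HM]. }
eapply Rle_trans; [apply Series_Rabs|apply Series_le; assumption].
apply @ex_series_le with (2 := Hgeo).
intros n; unfold norm; simpl; unfold abs; simpl.
rewrite Rabs_Rabsolu; apply Hle.
Qed.

(** * Power series whose coefficients change sign once *)

Lemma pow_lt_compat (x y : R) (n : nat) :
  0 < x < y -> (0 < n)%nat -> x ^ n < y ^ n.
Proof.
intros Hxy Hn; destruct n as [|n]; [lia|]; simpl.
assert (x ^ n <= y ^ n) by (apply pow_incr; lra).
assert (0 < x ^ n) by (apply pow_lt; lra).
nra.
Qed.

(** The termwise difference
    [c n (y^n x^k - x^n y^k) = c n (x y)^k (y^(n-k) - x^(n-k))] is never negative. *)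
Lemma single_sign_change (c : nat -> R) (k j : nat) (x y : R) :
  (forall n, (n < k)%nat -> c n <= 0) -> (forall n, (k < n)%nat -> 0 <= c n) ->
  0 < x < y -> ex_pseries c x -> ex_pseries c y ->
  j <> k -> c j <> 0 ->
  PSeries c x * y ^ k < PSeries c y * x ^ k.
Proof.
intros Hneg Hpos Hxy Hx Hy Hjk Hj.
apply ex_pseries_R in Hx; apply ex_pseries_R in Hy.
apply (ex_series_scal_r (y ^ k)) in Hx; apply (ex_series_scal_r (x ^ k)) in Hy.
pose (w n := y ^ n * x ^ k - x ^ n * y ^ k).
assert (Hlow : forall n, (n < k)%nat -> w n < 0).
{ intros n Hn; unfold w.
  replace k with (n + (k - n))%nat by lia; rewrite !pow_add.
  assert (x ^ (k - n) < y ^ (k - n)) by (apply pow_lt_compat; [lra|lia]).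
  assert (0 < x ^ n * y ^ n) by (apply Rmult_lt_0_compat; apply pow_lt; lra).
  nra. }
assert (Hhigh : forall n, (k < n)%nat -> 0 < w n).
{ intros n Hn; unfold w.
  replace n with (k + (n - k))%nat by lia; rewrite !pow_add.
  assert (x ^ (n - k) < y ^ (n - k)) by (apply pow_lt_compat; [lra|lia]).
  assert (0 < x ^ k * y ^ k) by (apply Rmult_lt_0_compat; apply pow_lt; lra).
  nra. }
assert (Hk : w k = 0) by (unfold w; ring).
assert (Hw : forall n, 0 <= c n * w n).
{ intros n; destruct (lt_eq_lt_dec n k) as [[Hn|Hn]|Hn].
  - specialize (Hneg n Hn); specialize (Hlow n Hn); nra.
  - rewrite Hn, Hk; lra.
  - specialize (Hpos n Hn); specialize (Hhigh n Hn); nra. }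
(* Strictness comes from this one term: a series of nonnegative terms is at least its [j]-th
   term. *)
assert (Hwj : 0 < c j * w j).
{ destruct (Rle_lt_or_eq_dec _ _ (Hw j)) as [Hlt|Heq]; [exact Hlt|].
  exfalso; symmetry in Heq; apply Rmult_integral in Heq.
  destruct Heq as [Heq|Heq]; [exact (Hj Heq)|].
  destruct (lt_eq_lt_dec j k) as [[Hn|Hn]|Hn].
  - specialize (Hlow j Hn); lra.
  - exact (Hjk Hn).
  - specialize (Hhigh j Hn); lra. }
assert (Hext : forall n,
  c n * y ^ n * x ^ k - c n * x ^ n * y ^ k = c n * w n)
  by (intros n; unfold w; ring).
assert (Hdiff := Series_minus _ _ Hy Hx).
cbv beta in Hdiff.
rewrite (Series_ext _ _ Hext), !Series_scal_r in Hdiff.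
assert (Hsum : ex_series (fun n => c n * w n)).
{ apply ex_series_ext with (1 := Hext).
  exact (ex_series_minus _ _ Hy Hx). }
assert (Hge := Series_ge_term _ j Hw Hsum).
unfold PSeries; lra.
Qed.

(** * The special functions: location of zeros, uniqueness, signs of the derivative *)

(** For [1 <= k], these are the Taylor coefficients at 0 of [special_fun k a]. *)
Definition special_coef (k : nat) (a : R) (n : nat) : R :=
  if Nat.eqb n 0 then 1
  else if Nat.ltb n k then -1
  else if Nat.eqb n k then a else 1.

Lemma special_coef_0 (k : nat) (a : R) : special_coef k a 0 = 1.
Proof. reflexivity. Qed.

Lemma special_coef_low (k : nat) (a : R) (n : nat) :
  (0 < n < k)%nat -> special_coef k a n = -1.
Proof.
intros Hn; unfold special_coef.
destruct (Nat.eqb_spec n 0); [lia|].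
destruct (Nat.ltb_spec n k); [reflexivity|lia].
Qed.

Lemma special_coef_mid (k : nat) (a : R) :
  (1 <= k)%nat -> special_coef k a k = a.
Proof.
intros Hn; unfold special_coef.
destruct (Nat.eqb_spec k 0); [lia|].
rewrite Nat.ltb_irrefl, Nat.eqb_refl; reflexivity.
Qed.

Lemma special_coef_high (k : nat) (a : R) (n : nat) :
  (k < n)%nat -> special_coef k a n = 1.
Proof.
intros Hn; unfold special_coef.
destruct (Nat.eqb_spec n 0); [reflexivity|].
destruct (Nat.ltb_spec n k); [lia|].
destruct (Nat.eqb_spec n k); [lia|reflexivity].
Qed.

Lemma special_coef_calB (k : nat) (a : R) :
  (1 <= k)%nat -> digit a -> calB (special_coef k a).
Proof.
intros Hk Ha; split; [reflexivity|].
intros n Hn; destruct (lt_eq_lt_dec n k) as [[H|H]|H].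
- left; apply special_coef_low; lia.
- rewrite H, special_coef_mid by exact Hk; exact Ha.
- right; right; apply special_coef_high; exact H.
Qed.

Lemma PSeries_special_coef (k : nat) (a x : R) :
  (1 <= k)%nat -> digit a -> Rabs x < 1 ->
  PSeries (special_coef k a) x = special_fun k a x.
Proof.
intros Hk Ha Hx.
assert (Hex := ex_pseries_bounded_coef _ 1 x
                 (calB_Rabs _ (special_coef_calB k a Hk Ha)) Hx).
rewrite (PSeries_decr_n _ k x Hex).
replace (PSeries (PS_decr_n (special_coef k a) (S k)) x) with (/ (1 - x)).
2:{ rewrite <- (Series_geom x Hx); unfold PSeries; apply Series_ext.
  intros n; unfold PS_decr_n; rewrite special_coef_high by lia; ring. }
unfold special_fun; rewrite Nat.add_1_r.
destruct k as [|k]; [lia|].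
rewrite Nat.sub_succ, Nat.sub_0_r, <- sum_n_Reals, sum_Sn.
rewrite special_coef_mid by exact Hk.
enough (Hs : forall m, (m <= k)%nat ->
  sum_n (fun i => special_coef (S k) a i * x ^ i) m
  = 1 - sum_n_m (fun j => x ^ j) 1 m).
{ rewrite (Hs k) by lia; unfold plus, Rdiv; simpl; reflexivity. }
induction m as [|m IH]; intros Hm.
- rewrite sum_O, sum_n_m_zero by lia; unfold zero; simpl.
  rewrite special_coef_0; ring.
- rewrite sum_Sn, IH, sum_n_Sm, special_coef_low by lia.
  unfold plus; simpl; ring.
Qed.

(** Multiplying by [1 - x] clears the geometric sums. Splitting [x ^ k] as
    [x ^ k * (1 - x) + x ^ (k + 1)] then makes every term after [1 - 2 * x] nonnegative for [x] in
    (0, 1) and [-1 <= a], which forces [1 - 2 * x < 0] at a zero. *)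
Lemma special_fun_closed_form (k : nat) (a x : R) :
  (1 <= k)%nat -> x < 1 ->
  special_fun k a x * (1 - x)
  = 1 - 2 * x + (1 + a) * x ^ k * (1 - x) + x ^ (k + 1) * 2.
Proof.
intros Hk Hx.
assert (Hs : forall m, (sum_n_m (fun j => x ^ j) 1 m) * (1 - x) = x - x ^ (m + 1)).
{ induction m as [|m IH].
  - rewrite sum_n_m_zero by lia; unfold zero; simpl; ring.
  - rewrite sum_n_Sm by lia; unfold plus; simpl plus.
    rewrite Rmult_plus_distr_r, IH, !Nat.add_1_r; simpl; ring. }
unfold special_fun.
specialize (Hs (k - 1)%nat); rewrite Nat.sub_add in Hs by exact Hk.
replace (x ^ (k + 1)) with (x ^ k * x) by (rewrite pow_add; ring).
field_simplify; [|lra].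
nra.
Qed.

Lemma special_fun_zero_gt_half (k : nat) (a x : R) :
  (1 <= k)%nat -> digit a -> 0 < x < 1 -> special_fun k a x = 0 -> 1 / 2 < x.
Proof.
intros Hk Ha Hx H0.
assert (Heq := special_fun_closed_form k a x Hk (proj2 Hx)).
assert (0 < x ^ k) by (apply pow_lt; lra).
assert (0 < x ^ (k + 1)) by (apply pow_lt; lra).
apply digit_bound in Ha.
rewrite H0 in Heq.
assert (0 <= (1 + a) * x ^ k * (1 - x)).
{ apply Rmult_le_pos; [apply Rmult_le_pos|]; lra. }
lra.
Qed.

(** The special coefficients take the least digit strictly between 0 and [k] and the greatest above
    [k], so the difference [c] changes sign only at [k]. As its series is zero at both [g] and [l],
    a nonzero coefficient off the pivot would contradict [single_sign_change]. *)
Lemma special_unique (k : nat) (a g l : R) (f : nat -> R) :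
  (1 <= k)%nat -> digit a -> 0 < g < l -> l < 1 ->
  vanishes_at_both g l (special_coef k a) -> vanishes_at_both g l f ->
  forall n, f n = special_coef k a n.
Proof.
intros Hk Ha Hgl Hl1 (HhB & Hhg & Hhl) (HfB & Hfg & Hfl).
pose (c := PS_minus (special_coef k a) f).
assert (Hex : forall e x, calB e -> 0 < x < 1 -> ex_pseries e x).
{ intros e x He Hx; apply ex_pseries_bounded_coef with 1.
  - apply calB_Rabs, He.
  - rewrite Rabs_pos_eq; lra. }
assert (Hc : forall n, c n = special_coef k a n - f n) by reflexivity.
assert (Hcx : forall x, 0 < x < 1 -> ex_pseries c x).
{ intros x Hx; apply ex_pseries_minus; apply Hex; assumption. }
assert (Hcg : PSeries c g = 0)
  by (unfold c; rewrite PSeries_minus, Hhg, Hfg by (apply Hex; [assumption|lra]); ring).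
assert (Hcl : PSeries c l = 0)
  by (unfold c; rewrite PSeries_minus, Hhl, Hfl by (apply Hex; [assumption|lra]); ring).
assert (Hpivot : forall p, (forall n, (n < p)%nat -> c n <= 0) ->
  (forall n, (p < n)%nat -> 0 <= c n) -> forall n, n <> p -> c n = 0).
{ intros p Hlow Hhigh n Hn; destruct (Req_dec (c n) 0) as [H|H]; [exact H|exfalso].
  enough (PSeries c g * l ^ p < PSeries c l * g ^ p) by (rewrite Hcg, Hcl in *; lra).
  apply single_sign_change with n; try assumption; apply Hcx; lra. }
assert (Hne : forall n, n <> k -> c n = 0).
{ apply Hpivot.
  - intros m Hm; rewrite Hc; destruct m as [|m].
    + rewrite special_coef_0, (proj1 HfB); lra.
    + rewrite special_coef_low by lia.
      assert (Hd := digit_bound _ (calB_digit _ HfB (S m))); lra.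
  - intros m Hm; rewrite Hc, special_coef_high by exact Hm.
    assert (Hd := digit_bound _ (calB_digit _ HfB m)); lra. }
(* Only index [k] remains. The other coefficients being zero, the pivot can move to [S k] or to 0
   according to the sign of [c k]; since [1 <= k], index [k] is then off the pivot. *)
assert (Hck : c k = 0).
{ destruct (Rle_dec (c k) 0) as [Hs|Hs].
  - apply (Hpivot (S k)); [| |lia]; intros n Hn.
    + destruct (Nat.eq_dec n k) as [->|H]; [exact Hs|rewrite Hne by exact H; lra].
    + rewrite Hne by lia; lra.
  - apply (Hpivot 0%nat); [| |lia]; intros n Hn; [lia|].
    destruct (Nat.eq_dec n k) as [->|H]; [lra|rewrite Hne by exact H; lra]. }
intros n; destruct (Nat.eq_dec n k) as [->|Hn];
  [rewrite Hc in Hck|specialize (Hne n Hn); rewrite Hc in Hne]; lra.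
Qed.

(** Rolle's argument for [h(x) / x] gives a zero [xi] of [x h'(x) - h(x)] between [g] and [l].
    Divided by [x^k], that function is strictly increasing, so it is negative at [g] and positive at
    [l], where it equals [g h'(g)] and [l h'(l)]. *)
Lemma special_derive_signs (k : nat) (a g l : R) (h := special_coef k a) :
  (1 <= k)%nat -> digit a -> 0 < g < l -> l < 1 ->
  PSeries h g = 0 -> PSeries h l = 0 ->
  Derive (PSeries h) g < 0 < Derive (PSeries h) l.
Proof.
intros Hk Ha Hgl Hl1 Hg Hl.
assert (HhB : calB h) by (apply special_coef_calB; assumption).
pose (dh := Derive (PSeries h)).
assert (Hdh : forall x, 0 < x < 1 -> is_derive (PSeries h) x (dh x)).
{ intros x Hx; apply is_derive_PSeries_calB; [exact HhB|].
  rewrite Rabs_pos_eq; lra. }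
(* The zeros of [x h'(x) - h(x)], the numerator of [(h(x) / x)'], are located by
   its coefficients [(n - 1) h_n], which change sign only once. *)
destruct (MVT_cor2 (fun x => PSeries h x / x)
            (fun x => (x * dh x - PSeries h x) / (x * x)) g l)
  as (xi & Hxi & Hgxl); [lra| |].
{ intros x Hx; apply is_derive_Reals.
  assert (Hd := Hdh x ltac:(lra)).
  evar_last.
  - apply (is_derive_div (PSeries h) (fun t => t) x (dh x) 1); [exact Hd| |lra].
    apply (is_derive_id x).
  - field; lra. }
rewrite Hg, Hl in Hxi.
assert (Hxi0 : xi * dh xi - PSeries h xi = 0).
{ set (A := xi * dh xi - PSeries h xi) in *.
  apply Rmult_eq_reg_r with ((l - g) / (xi * xi)).
  - transitivity (A / (xi * xi) * (l - g)); [field; lra|].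
    rewrite <- Hxi; field; split; lra.
  - apply Rgt_not_eq, Rdiv_lt_0_compat; nra. }
pose (c := PS_minus (PS_incr_1 (PS_derive h)) h).
assert (Hr : forall x, 0 < x < 1 -> Rbar_lt (Rabs x) (CV_radius h)).
{ intros x Hx; apply CV_radius_bounded_coef with 1; [apply calB_Rabs, HhB|].
  rewrite Rabs_pos_eq; lra. }
assert (Hex : forall x, 0 < x < 1 -> ex_pseries (PS_incr_1 (PS_derive h)) x).
{ intros x Hx; apply ex_pseries_incr_1, ex_pseries_derive, Hr, Hx. }
assert (Hcx : forall x, 0 < x < 1 -> ex_pseries c x).
{ intros x Hx; apply ex_pseries_minus; [apply Hex, Hx|apply CV_radius_inside, Hr, Hx]. }
assert (Hcv : forall x, 0 < x < 1 -> PSeries c x = x * dh x - PSeries h x).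
{ intros x Hx; unfold c, dh.
  rewrite PSeries_minus, PSeries_incr_1, Derive_PSeries;
    [reflexivity|apply Hr, Hx|apply Hex, Hx|apply CV_radius_inside, Hr, Hx]. }
assert (Hc : forall n, c n = (INR n - 1) * h n).
{ intros [|n]; unfold c, PS_minus, PS_plus, PS_opp, PS_incr_1, PS_derive, plus, opp, zero;
   cbv beta iota; simpl plus; [simpl; ring|simpl AbelianMonoid.zero; cbn -[INR]; ring]. }
assert (Hlt : forall x y, 0 < x < y -> y < 1 -> PSeries c x * y ^ k < PSeries c y * x ^ k).
(* Index 0 serves as the strict term: its coefficient is -1 and it differs from [k]. *)
{ intros x y Hxy Hy1; apply single_sign_change with 0%nat;
    try assumption; try (apply Hcx; lra); try lia.
  - intros [|n] Hn; rewrite Hc; unfold h; [rewrite special_coef_0; simpl; lra|].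
    rewrite special_coef_low by lia.
    rewrite S_INR; assert (H := pos_INR n); lra.
  - intros [|n] Hn; [lia|]; rewrite Hc; unfold h.
    rewrite special_coef_high by lia.
    rewrite S_INR; assert (H := pos_INR n); lra.
  - rewrite Hc; unfold h; rewrite special_coef_0; simpl; lra. }
assert (H1 := Hlt g xi ltac:(lra) ltac:(lra)).
assert (H2 := Hlt xi l ltac:(lra) ltac:(lra)).
rewrite (Hcv xi), Hxi0, Hcv, Hg in H1 by lra.
rewrite (Hcv xi), Hxi0, Hcv, Hl in H2 by lra.
assert (0 < xi ^ k) by (apply pow_lt; lra).
change (dh g < 0 < dh l).
split; apply Rnot_le_lt; intros Hle.
- assert (0 <= g * dh g * xi ^ k) by (repeat apply Rmult_le_pos; lra); lra.
- assert (0 <= l * - dh l * xi ^ k) by (repeat apply Rmult_le_pos; lra); lra.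
Qed.

Lemma special_corner_hypotheses (k : nat) (a g l : R) :
  (1 <= k)%nat -> digit a -> 0 < g -> g < l -> l < 1 ->
  special_fun k a g = 0 -> special_fun k a l = 0 ->
  corner_hypotheses g l (special_coef k a).
Proof.
intros Hk Ha H0 Hgl Hl1 Hg Hl.
assert (Hpg : PSeries (special_coef k a) g = 0).
{ rewrite PSeries_special_coef; try assumption; rewrite Rabs_pos_eq; lra. }
assert (Hpl : PSeries (special_coef k a) l = 0).
{ rewrite PSeries_special_coef; try assumption; rewrite Rabs_pos_eq; lra. }
assert (HB := special_coef_calB k a Hk Ha).
assert (Hv : vanishes_at_both g l (special_coef k a)) by (split; auto).
assert (Hd := special_derive_signs k a g l Hk Ha ltac:(lra) Hl1 Hpg Hpl).
split; [apply special_fun_zero_gt_half with k a; (assumption || lra)|].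
split; [exact Hgl|]; split; [exact Hl1|]; split; [exact Hv|].
split; [intros f Hf; apply special_unique with g l; (assumption || lra)|].
split; [exists (S k); intros n Hn; apply special_coef_high; lia|].
exact Hd.
Qed.

(** * Compactness of digit sequences and passage to the limit *)

(** Koenig's lemma for the ternary tree, for a family [Q] of properties that
    shrinks with its parameter. *)
Lemma digit_sequences_compact (Q : R -> (nat -> R) -> Prop) :
  (forall d e f, d <= e -> Q d f -> Q e f) ->
  (forall d f, Q d f -> forall n, digit (f n)) ->
  (forall d, 0 < d -> exists f, Q d f) ->
  exists p : nat -> R, forall N d, 0 < d ->
    exists f, Q d f /\ forall n, (n < N)%nat -> f n = p n.
Proof.
intros Hmono Hdig Hex.
(* A prefix is good when it extends to a member of [Q d] for every [d], however small; [pre]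
   prolongs good prefixes by one chosen digit at a time. *)
pose (good N (p : nat -> R) := forall d, 0 < d ->
  exists f, Q d f /\ forall n, (n < N)%nat -> f n = p n).
pose (upd (p : nat -> R) N c := fun n => if Nat.eqb n N then c else p n).
pose (pre := nat_rect (fun _ => nat -> R) (fun _ => 0)
  (fun N p => upd p N (epsilon (inhabits 0) (fun c => good (S N) (upd p N c))))).
assert (Hstep : forall N p, good N p -> exists c, good (S N) (upd p N c)).
{ intros N p Hp.
  (* A digit that fails does so for all [d] up to some [e]. If all three failed, a member of [Q d]
     with [d] the least of the three thresholds would have no possible digit at [N]. *)
  assert (Hbad : forall c, ~ good (S N) (upd p N c) -> exists e, 0 < e /\
    forall f d, d <= e -> Q d f -> (forall n, (n < N)%nat -> f n = p n) -> f N <> c).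
  { intros c Hc; apply NNPP; intros Hno; apply Hc; intros d Hd.
    apply NNPP; intros Hf; apply Hno; exists d; split; [exact Hd|].
    intros f d' Hd' HQ Hag HN; apply Hf; exists f; split.
    - exact (Hmono _ _ _ Hd' HQ).
    - intros n Hn; unfold upd; destruct (Nat.eqb_spec n N) as [->|HnN];
        [exact HN|apply Hag; lia]. }
  apply NNPP; intros Hno.
  destruct (Hbad (-1)) as (e1 & He1 & H1); [intros H; apply Hno; eauto|].
  destruct (Hbad 0) as (e2 & He2 & H2); [intros H; apply Hno; eauto|].
  destruct (Hbad 1) as (e3 & He3 & H3); [intros H; apply Hno; eauto|].
  pose (d := Rmin e1 (Rmin e2 e3)).
  assert (d <= e1) by apply Rmin_l.
  assert (d <= e2) by (eapply Rle_trans; [apply Rmin_r|apply Rmin_l]).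
  assert (d <= e3) by (eapply Rle_trans; [apply Rmin_r|apply Rmin_r]).
  destruct (Hp d) as (f & HQ & Hag); [repeat apply Rmin_pos; assumption|].
  destruct (Hdig d f HQ N) as [HN|[HN|HN]]; [eapply H1|eapply H2|eapply H3]; eauto. }
assert (Hgood : forall N, good N (pre N)).
{ induction N as [|N IH].
  - intros d Hd; destruct (Hex d Hd) as (f & Hf).
    exists f; split; [exact Hf|intros n Hn; lia].
  - exact (epsilon_spec (inhabits 0) _ (Hstep N (pre N) IH)). }
(* Entry [n] is fixed at stage [S n] and never overwritten, so the diagonal agrees with every later
   prefix. *)
assert (Hpre : forall N n, (n < N)%nat -> pre N n = pre (S n) n).
{ induction N as [|N IH]; intros n Hn; [lia|].
  destruct (Nat.eq_dec n N) as [->|HnN]; [reflexivity|].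
  transitivity (pre N n); [|apply IH; lia].
  simpl; unfold upd at 1; destruct (Nat.eqb_spec n N); [contradiction|reflexivity]. }
exists (fun n => pre (S n) n); intros N d Hd.
destruct (Hgood N d Hd) as (f & HQ & Hag); exists f; split; [exact HQ|].
intros n Hn; rewrite Hag, Hpre by exact Hn; reflexivity.
Qed.

(** Agreement up to [N] makes [f] and [p] uniformly close on [[0, r]] with [r < 1]. A zero of [f]
    near [x0] thus makes [p] small there, and continuity carries this over to [x0]. *)
Lemma PSeries_zero_of_approximation (p : nat -> R) (x0 : R) :
  calB p -> 0 < x0 < 1 ->
  (forall N d, 0 < d -> exists f x, calB f /\ Rabs (x - x0) < d /\
     PSeries f x = 0 /\ forall n, (n < N)%nat -> f n = p n) ->
  PSeries p x0 = 0.
Proof.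
intros Hp Hx0 Happ.
apply NNPP; intros Hne; apply Rabs_pos_lt in Hne.
set (v := Rabs (PSeries p x0)) in *.
assert (Hcont : continuity_pt (PSeries p) x0).
{ apply PSeries_continuity, CV_radius_bounded_coef with 1;
    [apply calB_Rabs, Hp|rewrite Rabs_pos_eq; lra]. }
destruct (proj1 (continuity_pt_locally _ _) Hcont (mkposreal (v / 2) ltac:(lra)))
  as ([d1 Hd1] & Hc); simpl in Hc.
pose (r := (1 + x0) / 2).
(* This threshold keeps the tail bound [2 * r ^ N / (1 - r)] below [v / 2]; continuity accounts for
   the other half of [v]. *)
destruct (pow_lt_1_zero r) with (y := v * (1 - r) / 4) as (N & HN).
{ unfold r; rewrite Rabs_pos_eq; lra. }
{ unfold r; nra. }
destruct (Happ N (Rmin d1 (Rmin x0 ((1 - x0) / 2)))) as (f & x & Hf & Hx & Hfx & Hag).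
{ repeat apply Rmin_pos; lra. }
apply Rmin_Rgt_l in Hx; destruct Hx as [Hx1 Hx].
apply Rmin_Rgt_l in Hx; destruct Hx as [Hx2 Hx3].
assert (Hxr : 0 < x <= r).
{ apply Rabs_def2 in Hx2; apply Rabs_def2 in Hx3; unfold r; lra. }
assert (Hr1 : r < 1) by (unfold r; lra).
assert (Hax : Rabs x < 1) by (rewrite Rabs_pos_eq; lra).
assert (Hpx : Rabs (PSeries p x) < v / 2).
{ replace (PSeries p x) with (PSeries (PS_minus p f) x).
  2:{ rewrite PSeries_minus, Hfx; [ring| |];
    apply ex_pseries_bounded_coef with 1; try apply calB_Rabs; assumption. }
  assert (Hpf : forall n, PS_minus p f n = p n - f n) by reflexivity.
  eapply Rle_lt_trans; [apply (PSeries_tail_bound _ 2 x N)|].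
  - intros n Hn; rewrite Hpf, Hag by exact Hn; ring.
  - intros n; rewrite Hpf.
    assert (H1 := digit_bound _ (calB_digit f Hf n)).
    assert (H2 := digit_bound _ (calB_digit p Hp n)).
    apply Rabs_le; lra.
  - lra.
  - specialize (HN N (Nat.le_refl N)).
    rewrite Rabs_pos_eq in HN by (apply pow_le; lra).
    assert (x ^ N <= r ^ N) by (apply pow_incr; lra).
    apply Rlt_div_l; [lra|].
    nra. }
specialize (Hc x Hx1).
assert (Htri := Rabs_triang_inv (PSeries p x0) (PSeries p x)).
rewrite Rabs_minus_sym in Hc; fold v in Htri; lra.
Qed.

(** * Quantitative estimates near a zero *)

(** The numbers [(n + 1) * r ^ n] are the terms of the differentiated geometric series, which
    converges at [r], so they tend to 0; taking [m = n + 1] only adds a factor [r < 1]. *)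
Lemma pow_mul_small (r eta : R) :
  0 < r < 1 -> 0 < eta ->
  exists K, forall m, (K <= m)%nat -> INR m * r ^ m < eta.
Proof.
intros Hr Heta.
assert (Hs : ex_pseries (PS_derive (fun _ => 1)) r).
{ apply ex_pseries_derive, CV_radius_bounded_coef with 1.
  - intros _; rewrite Rabs_R1; lra.
  - rewrite Rabs_pos_eq; lra. }
apply ex_pseries_R, ex_series_lim_0, is_lim_seq_spec in Hs.
destruct (Hs (mkposreal eta Heta)) as (K & HK); simpl in HK.
exists (S K); intros [|m] Hm; [lia|].
specialize (HK m ltac:(lia)); unfold PS_derive in HK.
rewrite Rminus_0_r, Rabs_pos_eq in HK.
- assert (0 < r ^ m) by (apply pow_lt; lra).
  assert (0 <= INR (S m)) by apply pos_INR.
  change (INR (S m) * (r * r ^ m) < eta).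
  assert (INR (S m) * r ^ m * r <= INR (S m) * r ^ m * 1).
  { apply Rmult_le_compat_l; [apply Rmult_le_pos|]; lra. }
  lra.
- apply Rmult_le_pos; [|apply pow_le; lra].
  apply Rmult_le_pos; [apply pos_INR|lra].
Qed.

(** From [1 + t <= exp t] with [t = (b - a) / a], the ratio [(b / a) ^ m] is at most [exp (m * t)],
    hence at most [q]. *)
Lemma pow_le_of_close (a b q : R) (m : nat) :
  0 < a <= b -> 0 < q -> INR m * (b - a) <= a * ln q -> b ^ m <= q * a ^ m.
Proof.
intros Hab Hq Hm.
assert (Hexp : b <= a * exp ((b - a) / a)).
{ replace b with (a * (1 + (b - a) / a)) at 1 by (field; lra).
  apply Rmult_le_compat_l; [lra|apply exp_ineq1_le]. }
apply Rle_trans with ((a * exp ((b - a) / a)) ^ m); [apply pow_incr; lra|].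
rewrite Rpow_mult_distr, Rmult_comm.
apply Rmult_le_compat_r; [apply pow_le; lra|].
rewrite <- Rpower_pow by apply exp_pos.
unfold Rpower; rewrite ln_exp.
rewrite <- (exp_ln q Hq).
assert (Hle : INR m * ((b - a) / a) <= ln q).
{ apply Rmult_le_reg_l with a; [lra|].
  replace (a * (INR m * ((b - a) / a))) with (INR m * (b - a)) by (field; lra).
  exact Hm. }
destruct (Rle_lt_or_eq_dec _ _ Hle) as [Hlt|Heq].
- apply Rlt_le, exp_increasing, Hlt.
- rewrite Heq; apply Rle_refl.
Qed.

Lemma derive_at_zero_estimate (F : R -> R) (x0 d q : R) :
  is_derive F x0 d -> F x0 = 0 -> d <> 0 -> 1 < q ->
  exists delta, 0 < delta /\ forall x, Rabs (x - x0) < delta ->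
    (F x = 0 -> x = x0) /\
    (0 < F x -> 0 < d * (x - x0) /\ d * (x - x0) <= q * F x /\ F x <= q * (d * (x - x0))).
Proof.
intros HF H0 Hd Hq; apply is_derive_Reals in HF.
assert (Hiq : 0 < / q < 1).
{ split; [apply Rinv_0_lt_compat; lra|]. rewrite <- Rinv_1; apply Rinv_lt_contravar; lra. }
assert (Habs := Rabs_pos_lt d Hd).
assert (Hiq' : 0 < 1 - / q) by lra.
(* With [s = d * (x - x0)], this tolerance puts [F x] between [s / q] and [(2 - / q) * s]; the upper
   factor is at most [q] because [2 <= q + / q]. *)
destruct (HF ((1 - / q) * Rabs d) (Rmult_lt_0_compat _ _ Hiq' Habs))
  as ([delta Hdelta] & HD); simpl in HD.
exists delta; split; [exact Hdelta|]; intros x Hx.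
destruct (Req_dec x x0) as [->|Hne]; [split; [auto|rewrite H0; lra]|].
assert (Hh : x - x0 <> 0) by lra.
specialize (HD (x - x0) Hh Hx).
replace (x0 + (x - x0)) with x in HD by ring; rewrite H0, Rminus_0_r in HD.
assert (Hest : Rabs (F x - d * (x - x0)) < (1 - / q) * Rabs (d * (x - x0))).
{ replace (F x - d * (x - x0)) with ((F x / (x - x0) - d) * (x - x0)) by (field; exact Hh).
  rewrite !Rabs_mult, <- Rmult_assoc.
  apply Rmult_lt_compat_r; [apply Rabs_pos_lt, Hh|exact HD]. }
assert (Hs : d * (x - x0) <> 0) by (apply Rmult_integral_contrapositive; auto).
set (s := d * (x - x0)) in *.
assert (Hqq : q * / q = 1) by (field; lra).
assert (H2 : 2 <= q + / q) by nra.
destruct (Rcase_abs s) as [Hneg|Hpos].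
- rewrite (Rabs_left s Hneg) in Hest; apply Rabs_def2 in Hest.
  assert (F x < 0) by nra.
  split; intros; lra.
- assert (Hs0 : 0 < s) by lra.
  rewrite (Rabs_right s Hpos) in Hest; apply Rabs_def2 in Hest.
  assert (s < q * F x) by nra.
  assert (F x < q * s) by nra.
  split; intros; [nra|lra].
Qed.

(** At [x] the series of [h - f] has the value of [h]. Its coefficients lie in [0, 2], vanish below
    [m] and reach at least 1 at [m]: the [m]-th term alone gives the lower bound, a geometric tail
    the upper one. *)
Lemma PSeries_first_difference_bounds (f h : nat -> R) (m : nat) (x : R) :
  calB f -> calB h -> (forall n, (n < m)%nat -> f n = h n) -> f m <> h m ->
  (forall n, (m <= n)%nat -> h n = 1) -> 0 < x < 1 -> PSeries f x = 0 ->
  x ^ m <= PSeries h x <= 2 * x ^ m / (1 - x).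
Proof.
intros Hf Hh Hag Hm H1 Hx Hfx.
assert (Hax : Rabs x < 1) by (rewrite Rabs_pos_eq; lra).
pose (c := PS_minus h f).
assert (Hc : forall n, c n = h n - f n) by reflexivity.
assert (Hcx : PSeries c x = PSeries h x).
{ unfold c; rewrite PSeries_minus, Hfx; [ring| |];
    apply ex_pseries_bounded_coef with 1; try apply calB_Rabs; assumption. }
assert (Hbd : forall n, 0 <= c n <= 2).
{ intros n; rewrite Hc; destruct (Nat.lt_ge_cases n m) as [Hn|Hn].
  - rewrite Hag by exact Hn; lra.
  - rewrite H1 by exact Hn.
    assert (Hd := digit_bound _ (calB_digit f Hf n)); lra. }
assert (Hcabs : forall n, Rabs (c n) <= 2).
{ intros n; rewrite Rabs_pos_eq; apply Hbd. }
assert (Hcm : 1 <= c m).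
{ rewrite Hc; rewrite H1 in * by lia.
  destruct (calB_digit f Hf m) as [H|[H|H]]; lra. }
rewrite <- Hcx; split.
- apply Rle_trans with (c m * x ^ m).
  { assert (0 < x ^ m) by (apply pow_lt; lra); nra. }
  apply (Series_ge_term (fun n => c n * x ^ n)).
  + intros n; apply Rmult_le_pos; [apply Hbd|apply pow_le; lra].
  + apply ex_pseries_R, ex_pseries_bounded_coef with 2; assumption.
- eapply Rle_trans; [apply Rle_abs|].
  apply PSeries_tail_bound; [|exact Hcabs|lra].
  intros n Hn; rewrite Hc, Hag by exact Hn; ring.
Qed.

(** * Comparison with [h] up to the first index of disagreement *)

(** Otherwise, for every [delta], some [f] with zeros that close to [g] and [l] departs from [h]
    before index [K]. Compactness yields a limit [p] vanishing at [g] and [l], equal to [h] by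
    uniqueness, yet sharing its first [K] digits with such an [f]. *)
Lemma calB_zeros_stable (g l : R) (h : nat -> R) (K : nat) :
  0 < g < 1 -> 0 < l < 1 ->
  (forall f, vanishes_at_both g l f -> forall n, f n = h n) ->
  exists delta, 0 < delta /\ forall f x y, calB f ->
    Rabs (x - g) < delta -> Rabs (y - l) < delta ->
    PSeries f x = 0 -> PSeries f y = 0 ->
    forall n, (n < K)%nat -> f n = h n.
Proof.
intros Hg Hl Huniq; apply NNPP; intros Hno.
pose (Q d f := calB f /\ (exists x y, Rabs (x - g) < d /\ Rabs (y - l) < d /\
   PSeries f x = 0 /\ PSeries f y = 0) /\ exists n, (n < K)%nat /\ f n <> h n).
destruct (digit_sequences_compact Q) as (p & Hp).
- intros d e f Hde (Hf & (x & y & Hx & Hy & Hxy) & Hdiff).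
  repeat split; try assumption; try apply Hf.
  exists x, y; repeat split; (apply Hxy || lra).
- intros d f (Hf & _); exact (calB_digit f Hf).
- intros d Hd; apply NNPP; intros HQ; apply Hno; exists d; split; [exact Hd|].
  intros f x y Hf Hx Hy Hfx Hfy n Hn; apply NNPP; intros Hne; apply HQ.
  exists f; repeat split; try apply Hf; [|eauto].
  exists x, y; auto.
- assert (HpB : calB p).
  { split.
    - destruct (Hp 1%nat 1 Rlt_0_1) as (f & (Hf & _) & Hag).
      rewrite <- Hag by lia; apply Hf.
    - intros n _; destruct (Hp (S n) 1 Rlt_0_1) as (f & (Hf & _) & Hag).
      rewrite <- Hag by lia; apply calB_digit, Hf. }
  assert (Hpv : vanishes_at_both g l p).
  { split; [exact HpB|]; split; apply PSeries_zero_of_approximation; try assumption;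
    intros N d Hd; destruct (Hp N d Hd) as (f & (Hf & (x & y & Hxy) & _) & Hag);
    [exists f, x|exists f, y]; repeat split; (apply Hf || apply Hxy || apply Hag). }
  destruct (Hp K 1 Rlt_0_1) as (f & (_ & _ & n & Hn & Hne) & Hag).
  apply Hne; rewrite Hag by exact Hn; apply Huniq, Hpv.
Qed.

Lemma first_difference (f h : nat -> R) :
  (forall n, f n = h n) \/
  exists m, f m <> h m /\ forall n, (n < m)%nat -> f n = h n.
Proof.
destruct (classic (exists n, f n <> h n)) as [[n Hn]|Hno].
- right.
  destruct (dec_inh_nat_subset_has_unique_least_element (fun i => f i <> h i))
    as (m & (Hm & Hmin) & _).
  + intros i; apply classic.
  + exists n; exact Hn.
  + exists m; split; [exact Hm|]; intros i Hi; apply NNPP; intros Hne.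
    specialize (Hmin i Hne); lia.
- left; intros n; apply NNPP; intros Hn; apply Hno; exists n; exact Hn.
Qed.

(** Near [(g0, l0)] both deviations are comparable, up to powers of [q], to the
    [m]-th powers of [g0] and [l0], where [m] is the first index at which a
    function vanishing at [x] and [y] differs from [h]. *)
Lemma corner_power_estimates (g0 l0 : R) (h : nat -> R) (q : R) :
  corner_hypotheses g0 l0 h -> 1 < q ->
  let dg := Derive (PSeries h) g0 in
  let dl := Derive (PSeries h) l0 in
  exists delta, 0 < delta /\ forall x y f,
    Rabs (x - g0) < delta -> Rabs (y - l0) < delta ->
    vanishes_at_both x y f -> (x, y) <> (g0, l0) ->
    exists m, x < g0 /\ l0 < y /\
      g0 ^ m <= q ^ 2 * (- dg * (g0 - x)) /\
      (1 - g0) * (- dg * (g0 - x)) <= 2 * q * g0 ^ m /\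
      l0 ^ m <= q * (dl * (y - l0)) /\
      (1 - l0) * (dl * (y - l0)) <= 2 * q ^ 3 * l0 ^ m.
Proof.
intros (Hg0 & Hgl & Hl1 & (HhB & Hhg & Hhl) & Huniq & (K0 & HK0) & Hdg & Hdl) Hq dg dl.
fold dg in Hdg; fold dl in Hdl.
assert (Hder : forall x, 0 < x < 1 -> is_derive (PSeries h) x (Derive (PSeries h) x)).
{ intros x Hx; apply is_derive_PSeries_calB; [exact HhB|rewrite Rabs_pos_eq; lra]. }
destruct (derive_at_zero_estimate (PSeries h) g0 dg q) as (d1 & Hd1 & Hest1);
  [apply Hder; lra|exact Hhg|lra|exact Hq|].
destruct (derive_at_zero_estimate (PSeries h) l0 dl q) as (d2 & Hd2 & Hest2);
  [apply Hder; lra|exact Hhl|lra|exact Hq|].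
assert (Hlnq : 0 < ln q) by (rewrite <- ln_1; apply ln_increasing; lra).
(* Both [g0] and [y] will lie below [r], so [r ^ m] is a common scale: [g0 - x <= A * r ^ m] and
   [y - l0 <= B * r ^ m]. *)
pose (r := (1 + l0) / 2).
assert (Hr : 0 < r < 1 /\ l0 < r) by (unfold r; lra).
pose (A := 2 * q / (- dg * (1 - g0))).
pose (B := 2 * q / (dl * (1 - r))).
assert (HA : 0 < A) by (apply Rdiv_lt_0_compat; nra).
assert (HB : 0 < B) by (apply Rdiv_lt_0_compat; nra).
(* Beyond [K1], [m] times either deviation is at most [ln q / 2], which suits [pow_le_of_close] with
   base [x] or [l0], both above 1/2. *)
destruct (pow_mul_small r (ln q / 2 / (A + B))) as (K1 & HK1);
  [lra|repeat apply Rdiv_lt_0_compat; lra|].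
destruct (calB_zeros_stable g0 l0 h (Nat.max K0 K1)) as (d3 & Hd3 & Hstab);
  [lra|lra|exact Huniq|].
assert (Hqi : 0 < / q < 1).
{ split; [apply Rinv_0_lt_compat; lra|]. rewrite <- Rinv_1; apply Rinv_lt_contravar; lra. }
assert (Hqq : q * / q = 1) by (field; lra).
(* The three bounds secure, in order, [1 / 2 < x], [y < r] and [1 - l0 <= q * (1 - y)]. *)
pose (d4 := Rmin (g0 - 1 / 2) (Rmin ((1 - l0) / 2) ((1 - l0) * (1 - / q)))).
exists (Rmin d1 (Rmin d2 (Rmin d3 d4))); split.
{ unfold d4; repeat apply Rmin_pos; try lra; apply Rmult_lt_0_compat; lra. }
intros x y f Hx Hy (HfB & Hfx & Hfy) Hxy.
assert (Hsplit : forall a b c : R, c < Rmin a b -> c < a /\ c < b).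
{ intros a b c H; apply Rmin_Rgt_l in H; exact H. }
apply Hsplit in Hx; destruct Hx as [Hx1 Hx]; apply Hsplit in Hx; destruct Hx as [_ Hx].
apply Hsplit in Hx; destruct Hx as [Hx3 Hx]; apply Hsplit in Hx; destruct Hx as [Hx4 Hx].
apply Hsplit in Hx; destruct Hx as [Hx5 _].
apply Hsplit in Hy; destruct Hy as [_ Hy]; apply Hsplit in Hy; destruct Hy as [Hy2 Hy].
apply Hsplit in Hy; destruct Hy as [Hy3 Hy]; apply Hsplit in Hy; destruct Hy as [_ Hy].
apply Hsplit in Hy; destruct Hy as [Hy5 Hy6].
specialize (Hest1 x Hx1); specialize (Hest2 y Hy2).
specialize (Hstab f x y HfB Hx3 Hy3 Hfx Hfy).
apply Rabs_def2 in Hx4; apply Rabs_def2 in Hx5; apply Rabs_def2 in Hy5; apply Rabs_def2 in Hy6.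
(* If [f] coincides with [h], then [x] and [y] are zeros of [h]; as [g0] and [l0] are isolated
   zeros, this gives the excluded point. *)
destruct (first_difference f h) as [Heq|(m & Hm & Hag)].
{ exfalso; apply Hxy.
  rewrite (PSeries_ext f h x Heq) in Hfx; rewrite (PSeries_ext f h y Heq) in Hfy.
  rewrite (proj1 Hest1 Hfx), (proj1 Hest2 Hfy); reflexivity. }
assert (HmK : (Nat.max K0 K1 <= m)%nat).
{ destruct (Nat.le_gt_cases (Nat.max K0 K1) m) as [H|H]; [exact H|].
  exfalso; exact (Hm (Hstab m H)). }
assert (Hbd : forall t, 0 < t < 1 -> PSeries f t = 0 ->
  t ^ m <= PSeries h t <= 2 * t ^ m / (1 - t)).
{ intros t; apply PSeries_first_difference_bounds; try assumption.
  intros n Hn; apply HK0; lia. }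
specialize (HK1 m ltac:(lia)).
assert (Hy1 : y < r) by (unfold r; lra).
assert (Hbx := Hbd x ltac:(lra) Hfx).
assert (Hby := Hbd y ltac:(lra) Hfy).
assert (Hxm : 0 < x ^ m) by (apply pow_lt; lra).
assert (Hym : 0 < y ^ m) by (apply pow_lt; lra).
(* Positivity of [h] at [x] and [y], with the signs of [dg] and [dl], selects the quadrant. *)
destruct Hest1 as [_ Hest1]; destruct (Hest1 ltac:(lra)) as (Hu0 & Hu1 & Hu2).
destruct Hest2 as [_ Hest2]; destruct (Hest2 ltac:(lra)) as (Hv0 & Hv1 & Hv2).
replace (dg * (x - g0)) with (- dg * (g0 - x)) in Hu0, Hu1, Hu2 by ring.
assert (Hxg : x < g0) by nra.
assert (Hyl : l0 < y) by nra.
assert (Hdiv : forall a b c t, 0 < t < 1 -> a <= q * b -> b <= 2 * c / (1 - t) ->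
  (1 - t) * a <= 2 * q * c).
{ intros a b c t Ht Ha Hb; apply Rle_div_r in Hb; [|lra].
  apply Rle_trans with ((1 - t) * (q * b)); [apply Rmult_le_compat_l; lra|].
  replace ((1 - t) * (q * b)) with (q * (b * (1 - t))) by ring.
  replace (2 * q * c) with (q * (2 * c)) by ring.
  apply Rmult_le_compat_l; lra. }
assert (Hux := Hdiv _ _ _ x ltac:(lra) Hu1 (proj2 Hbx)).
assert (Hvy := Hdiv _ _ _ y ltac:(lra) Hv1 (proj2 Hby)).
assert (Hxgm : x ^ m <= g0 ^ m) by (apply pow_incr; lra).
assert (Hlym : l0 ^ m <= y ^ m) by (apply pow_incr; lra).
assert (Hgrm : g0 ^ m <= r ^ m) by (apply pow_incr; lra).
assert (Hyrm : y ^ m <= r ^ m) by (apply pow_incr; lra).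
(* Since [x < g0], passing from [x] to [g0] shrinks the factor on the left and enlarges the power on
   the right, so no further [q] is lost. *)
assert (Hug : (1 - g0) * (- dg * (g0 - x)) <= 2 * q * g0 ^ m).
{ apply Rle_trans with ((1 - x) * (- dg * (g0 - x))).
  - apply Rmult_le_compat_r; lra.
  - apply Rle_trans with (1 := Hux), Rmult_le_compat_l; lra. }
assert (HuA : g0 - x <= A * r ^ m).
{ apply Rmult_le_reg_l with (- dg * (1 - g0)); [apply Rmult_lt_0_compat; lra|].
  replace (- dg * (1 - g0) * (A * r ^ m)) with (2 * q * r ^ m)
    by (unfold A; field; split; lra).
  apply Rle_trans with (2 * q * g0 ^ m); [lra|apply Rmult_le_compat_l; lra]. }
assert (HvB : y - l0 <= B * r ^ m).
{ apply Rmult_le_reg_l with (dl * (1 - r)); [apply Rmult_lt_0_compat; lra|].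
  replace (dl * (1 - r) * (B * r ^ m)) with (2 * q * r ^ m)
    by (unfold B; field; split; lra).
  apply Rle_trans with (2 * q * y ^ m); [|apply Rmult_le_compat_l; lra].
  apply Rle_trans with (2 := Hvy).
  replace (dl * (1 - r) * (y - l0)) with ((1 - r) * (dl * (y - l0))) by ring.
  apply Rmult_le_compat_r; lra. }
assert (HmAB : INR m * ((A + B) * r ^ m) <= 1 / 2 * ln q).
{ apply Rlt_div_r in HK1; [|lra]; lra. }
assert (Hrm : 0 < r ^ m) by (apply pow_lt; lra).
assert (Hm0 : 0 <= INR m) by apply pos_INR.
assert (Hclose : forall d c, d <= (A + B) * r ^ m -> 1 / 2 <= c -> INR m * d <= c * ln q).
{ intros d c Hd Hc; apply Rle_trans with (1 / 2 * ln q); [|apply Rmult_le_compat_r; lra].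
  apply Rle_trans with (2 := HmAB), Rmult_le_compat_l; assumption. }
(* Comparing the powers in the opposite direction costs one factor [q] at each point. *)
assert (Hgx : g0 ^ m <= q * x ^ m).
{ apply pow_le_of_close; [lra|lra|]; apply Hclose; nra. }
assert (Hyq : y ^ m <= q * l0 ^ m).
{ apply pow_le_of_close; [lra|lra|]; apply Hclose; nra. }
exists m; repeat split; try assumption.
- replace (q ^ 2 * (- dg * (g0 - x))) with (q * (q * (- dg * (g0 - x)))) by ring.
  apply Rle_trans with (1 := Hgx), Rmult_le_compat_l; lra.
- lra.
- assert (Hly : 1 - l0 <= q * (1 - y)).
  { apply Rmult_le_reg_l with (/ q); [lra|].
    replace (/ q * (q * (1 - y))) with (q * / q * (1 - y)) by ring.
    rewrite Hqq; lra. }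
  apply Rle_trans with (q * ((1 - y) * (dl * (y - l0)))).
  { rewrite <- (Rmult_assoc q (1 - y)); apply Rmult_le_compat_r; lra. }
  replace (2 * q ^ 3 * l0 ^ m) with (q * (2 * q * (q * l0 ^ m))) by ring.
  apply Rmult_le_compat_l; [lra|].
  apply Rle_trans with (1 := Hvy), Rmult_le_compat_l; lra.
Qed.

(** * From the index [m] to the explicit corner region *)

Lemma disk_coordinates (d a b : R) (z : R * R) :
  disk d (a, b) z -> Rabs (fst z - a) < d /\ Rabs (snd z - b) < d.
Proof.
unfold disk, dist_euc; simpl; intros H.
assert (Hsq : forall u v, Rabs (- u) <= sqrt (Rsqr u + Rsqr v)).
{ intros u v; rewrite Rabs_Ropp, <- sqrt_Rsqr_abs; apply sqrt_le_1_alt.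
  assert (H0 := Rle_0_sqr v); lra. }
split.
- replace (fst z - a) with (- (a - fst z)) by ring.
  eapply Rle_lt_trans; [apply Hsq|exact H].
- replace (snd z - b) with (- (b - snd z)) by ring.
  rewrite Rplus_comm in H; eapply Rle_lt_trans; [apply Hsq|exact H].
Qed.

(** Source of the exponent: [a] raised to [ln b / ln a] is [b], which lets the unknown [m] be
    eliminated between the two deviations. *)
Lemma Rpower_pow_log_ratio (a b : R) (m : nat) :
  0 < a < 1 -> 0 < b -> Rpower (a ^ m) (ln b / ln a) = b ^ m.
Proof.
intros Ha Hb.
assert (Hlna : ln a < 0) by (rewrite <- ln_1; apply ln_increasing; lra).
rewrite <- !Rpower_pow, Rpower_mult by lra.
unfold Rpower; f_equal; field; lra.
Qed.

(** Raising the bounds that relate [g0 ^ m] and [g0 - x] to the power [alpha] gives bounds on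
    [l0 ^ m], which are chained with those on [y - l0]. *)
Lemma corner_inclusion_explicit (g0 l0 : R) (h : nat -> R) :
  corner_hypotheses g0 l0 h ->
  let alpha := ln l0 / ln g0 in
  let dg := Derive (PSeries h) g0 in
  let dl := Derive (PSeries h) l0 in
  exists delta, 0 < delta /\
    corner_inclusion g0 l0 alpha delta
      (2 * Rpower (Rabs dg) alpha * Rpower (1 - g0) alpha / (Rpower 2 alpha * 3 * dl))
      (Rpower 3 alpha * 2 * Rpower (Rabs dg) alpha / (Rpower 2 alpha * (1 - l0) * dl)).
Proof.
intros Hcorner alpha dg dl.
assert (Hq : 1 < Rpower (3 / 2) (alpha / 6) /\ 0 < alpha < 1).
{ assert (H : 0 < alpha < 1).
  { destruct Hcorner as (Hg0 & Hgl & Hl1 & _).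
    assert (Hlng : ln g0 < ln l0) by (apply ln_increasing; lra).
    assert (Hlnl : ln l0 < 0) by (rewrite <- ln_1; apply ln_increasing; lra).
    unfold alpha; replace (ln l0 / ln g0) with (- ln l0 / - ln g0) by (field; lra).
    split; [apply Rdiv_lt_0_compat; lra|].
    apply Rlt_div_l; lra. }
  split; [|exact H].
  rewrite <- (Rpower_O (3 / 2)) by lra; apply Rpower_lt; lra. }
destruct Hq as [Hq Halpha].
(* The accumulated losses are [q^(1 + alpha)] for [C1] and [q^(3 + 2 alpha)] for [C2]. As
   [alpha < 1], this [q] keeps them below [3/2] and [(3/2)^alpha], the room left in the two
   constants. *)
set (q := Rpower (3 / 2) (alpha / 6)) in *.
assert (Hq1 : q * Rpower q alpha < 3 / 2).
{ unfold q; rewrite Rpower_mult, <- Rpower_plus.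
  rewrite <- (Rpower_1 (3 / 2)) at 2 by lra.
  apply Rpower_lt; [lra|nra]. }
assert (Hq2 : q ^ 3 * Rpower (q ^ 2) alpha < Rpower (3 / 2) alpha).
{ rewrite <- !Rpower_pow by lra.
  unfold q; rewrite !Rpower_mult, <- Rpower_plus.
  apply Rpower_lt; [lra|simpl; nra]. }
destruct (corner_power_estimates g0 l0 h q Hcorner Hq) as (delta & Hdelta & Hest).
fold dg dl in Hest.
destruct Hcorner as (Hg0 & Hgl & Hl1 & _ & _ & _ & Hdg & Hdl).
fold dg in Hdg; fold dl in Hdl.
exists delta; split; [exact Hdelta|].
intros [x y] Hz (_ & _ & _ & f & Hf) Hne.
apply disk_coordinates in Hz; simpl in Hz, Hf.
destruct (Hest x y f (proj1 Hz) (proj2 Hz) Hf Hne)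
  as (m & Hxg & Hly & H1 & H2 & H3 & H4).
rewrite (Rabs_left dg Hdg).
split; [exact Hxg|]; simpl.
set (u := - dg * (g0 - x)) in *.
assert (Hu : 0 < u) by (apply Rmult_lt_0_compat; lra).
assert (Hupow : Rpower (- dg) alpha * Rpower (g0 - x) alpha = Rpower u alpha)
  by (apply Rpower_mult_distr; lra).
assert (Hgm : 0 < g0 ^ m) by (apply pow_lt; lra).
assert (Hlm : Rpower (g0 ^ m) alpha = l0 ^ m) by (apply Rpower_pow_log_ratio; lra).
assert (Hpos : forall s, 0 < Rpower s alpha) by (intros s; apply exp_pos).
assert (Hlow : Rpower (1 - g0) alpha * Rpower u alpha
               <= Rpower 2 alpha * (Rpower q alpha * l0 ^ m)).
{ rewrite <- Hlm, !Rpower_mult_distr by (try lra; apply Rmult_lt_0_compat; lra).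
  apply Rle_Rpower_l; [lra|]; split; [apply Rmult_lt_0_compat; lra|lra]. }
assert (Hup : l0 ^ m <= Rpower (q ^ 2) alpha * Rpower u alpha).
{ assert (0 < q ^ 2) by (apply pow_lt; lra).
  rewrite <- Hlm, !Rpower_mult_distr by lra.
  apply Rle_Rpower_l; lra. }
assert (Hdy : 0 < dl * (y - l0)) by (apply Rmult_lt_0_compat; lra).
assert (Hlm0 : 0 < l0 ^ m) by (apply pow_lt; lra).
assert (P2 := Hpos 2). assert (Pq := Hpos q). assert (Pu := Hpos u).
split.
- replace (_ / _ * _) with (2 * (Rpower (1 - g0) alpha * Rpower u alpha)
      / (3 * Rpower 2 alpha * dl))
    by (rewrite <- Hupow; field; lra).
  apply Rlt_div_l; [repeat apply Rmult_lt_0_compat; lra|].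
  apply Rle_lt_trans with (2 * (Rpower 2 alpha * (Rpower q alpha * l0 ^ m))); [lra|].
  apply Rle_lt_trans with (2 * (Rpower 2 alpha * (Rpower q alpha * (q * (dl * (y - l0)))))).
  { repeat (apply Rmult_le_compat_l; [lra|]); exact H3. }
  replace (2 * (Rpower 2 alpha * (Rpower q alpha * (q * (dl * (y - l0))))))
    with (2 * Rpower 2 alpha * (dl * (y - l0)) * (q * Rpower q alpha)) by ring.
  replace ((y - l0) * (3 * Rpower 2 alpha * dl))
    with (2 * Rpower 2 alpha * (dl * (y - l0)) * (3 / 2)) by field.
  apply Rmult_lt_compat_l; [repeat apply Rmult_lt_0_compat; lra|exact Hq1].
- assert (H32 : Rpower 3 alpha = Rpower (3 / 2) alpha * Rpower 2 alpha).
  { rewrite Rpower_mult_distr by lra; f_equal; lra. }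
  replace (_ / _ * _) with (2 * (Rpower (3 / 2) alpha * Rpower u alpha)
      / ((1 - l0) * dl))
    by (rewrite <- Hupow, H32; field; lra).
  apply Rlt_div_r; [apply Rmult_lt_0_compat; lra|].
  replace ((y - l0) * ((1 - l0) * dl)) with ((1 - l0) * (dl * (y - l0))) by ring.
  apply Rle_lt_trans with (1 := H4).
  assert (0 < q ^ 3) by (apply pow_lt; lra).
  apply Rle_lt_trans with (2 * q ^ 3 * (Rpower (q ^ 2) alpha * Rpower u alpha)).
  { apply Rmult_le_compat_l; lra. }
  replace (2 * q ^ 3 * (Rpower (q ^ 2) alpha * Rpower u alpha))
    with (2 * ((q ^ 3 * Rpower (q ^ 2) alpha) * Rpower u alpha)) by ring.
  apply Rmult_lt_compat_l; [lra|]; apply Rmult_lt_compat_r; assumption.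
Qed.

Theorem theorem2p3 :
  (forall (g0 l0 : R) (h : nat -> R),
     corner_hypotheses g0 l0 h ->
     let alpha := ln l0 / ln g0 in
     let dg := Derive (PSeries h) g0 in
     let dl := Derive (PSeries h) l0 in
     (exists delta C1 C2 : R,
        0 < delta /\ 0 < C1 /\ 0 < C2 /\
        corner_inclusion g0 l0 alpha delta C1 C2) /\
     (let C1 := 2 * Rpower (Rabs dg) alpha * Rpower (1 - g0) alpha
                / (Rpower 2 alpha * 3 * dl) in
      let C2 := Rpower 3 alpha * 2 * Rpower (Rabs dg) alpha
                / (Rpower 2 alpha * (1 - l0) * dl) in
      0 < C1 /\ 0 < C2 /\
      exists delta : R,
        0 < delta /\ corner_inclusion g0 l0 alpha delta C1 C2)) /\
  (forall (k : nat) (a g0 l0 : R),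
     (1 <= k)%nat -> digit a ->
     0 < g0 -> g0 < l0 -> l0 < 1 ->
     special_fun k a g0 = 0 -> special_fun k a l0 = 0 ->
     exists h : nat -> R,
       (forall x : R, Rabs x < 1 -> PSeries h x = special_fun k a x) /\
       corner_hypotheses g0 l0 h).
Proof.
split.
- intros g0 l0 h Hcorner alpha dg dl.
  destruct (corner_inclusion_explicit g0 l0 h Hcorner) as (delta & Hdelta & Hincl).
  fold alpha dg dl in Hincl.
  destruct Hcorner as (Hg0 & Hgl & Hl1 & _ & _ & _ & Hdg & Hdl).
  fold dg in Hdg; fold dl in Hdl.
  assert (Hpos : forall s, 0 < Rpower s alpha) by (intros s; apply exp_pos).
  assert (HC1 : 0 < 2 * Rpower (Rabs dg) alpha * Rpower (1 - g0) alpha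
                    / (Rpower 2 alpha * 3 * dl)).
  { apply Rdiv_lt_0_compat; repeat apply Rmult_lt_0_compat; try apply Hpos; lra. }
  assert (HC2 : 0 < Rpower 3 alpha * 2 * Rpower (Rabs dg) alpha
                    / (Rpower 2 alpha * (1 - l0) * dl)).
  { apply Rdiv_lt_0_compat; repeat apply Rmult_lt_0_compat; try apply Hpos; lra. }
  split; [|simpl; eauto].
  eexists delta, _, _; eauto.
- intros k a g0 l0 Hk Ha H0 Hgl Hl1 Hg Hl.
  exists (special_coef k a); split.
  + intros x Hx; apply PSeries_special_coef; assumption.
  + apply special_corner_hypotheses; assumption.
Qed.
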